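(* Let $\Gamma^1=(G,\sigma_1,\mu_1)$ be a $\gamma_1$-regular signed graph on $n_1$ vertices and $m_1$ edges, let $\theta$ be any $r$-orientation of the edges of $\Gamma^1$, and let $\Gamma^2=(H,\sigma_2,\mu_2)$ be an arbitrary signed graph on $n_2$ vertices. Let $\lambda_1(Q(\Gamma^1)),\dots,\lambda_{n_1}(Q(\Gamma^1))$ be the eigenvalues of $Q(\Gamma^1)$. If $\lambda$ is not a pole of $\Sigma_{Q(\Gamma^2)}(\lambda-\gamma_1)$, then $$f_{Q((\Gamma^1\boxdot\Gamma^2)_\theta)}(\lambda)=(\lambda-2-2n_2)^{m_1-n_1}\big(f_{Q(\Gamma^2)}(\lambda-\gamma_1)\big)^{n_1}\prod_{j=1}^{n_1}\Big(\lambda^2-(\gamma_1+2+2n_2)\lambda+2\gamma_1(n_2+1)-\big(1+(\lambda-\gamma_1)\Sigma_{Q(\Gamma^2)}(\lambda-\gamma_1)\big)\lambda_j(Q(\Gamma^1))\Big).$$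
   Context: A signed graph $\Gamma=(G,\sigma,\mu)$ has a finite simple graph $G$ with vertices $v_1,\dots,v_n$, signature $\sigma:E(G)\to\{\pm1\}$ and marking $\mu:V(G)\to\{\pm1\}$; $\mu(\Gamma)=(\mu(v_1),\dots,\mu(v_n))^T$. $A(\Gamma)$ has $(i,j)$ entry $\sigma(v_iv_j)$ if $v_i\sim v_j$ and $0$ otherwise; $D(\Gamma)$ is the diagonal matrix of (unsigned) degrees; $Q(\Gamma)=D(\Gamma)+A(\Gamma)$. $\gamma$-regular means all degrees equal $\gamma$. $f_M(\lambda)=\det(\lambda I-M)$. The signed $N$-coronal is the rational function $\Sigma_N(X)=\mu(\Gamma)^T(XI_n-N)^{-1}\mu(\Gamma)$. An $r$-orientation of $(G,\sigma)$ is a map $\theta:V(G)\times E(G)\to\{-1,0,1\}$ with $\theta(w,uv)=0$ for $w\notin\{u,v\}$, $\theta(u,uv)\in\{\pm1\}$ at endpoints, and $\theta(u,uv)\theta(v,uv)=\sigma(uv)$. The subdivision graph $S(\Gamma^1_\theta)$ is obtained by inserting a new vertex $v_e$ into each edge $e$ of $\Gamma^1$, the edge $v_iv_e$ having sign $\theta(v_i,e)$. With $V(\Gamma^1)=\{v_1,\dots,v_{n_1}\}$, the subdivision vertex neighbourhood corona $(\Gamma^1\boxdot\Gamma^2)_\theta$ is obtained from $S(\Gamma^1_\theta)$ and $n_1$ disjoint copies of $\Gamma^2$ by joining, for each $t$, every inserted vertex $v_e$ with $e$ incident to $v_t$ to every vertex $u$ of the $t$-th copy, with sign $\theta(v_t,e)\mu_2(u)$,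 where $\mu_2(u)$ is the marking of the corresponding vertex of $\Gamma^2$.
   Formalization: When m_1 < n_1 (so γ_1 is 0 or 1), the value λ = 2 + 2n_2 is excluded, because there the factor (λ-2-2n_2)^{m_1-n_1} would be a negative power of zero and the right side is undefined. *)

(* Defs.v *)
From HB Require Import structures.
From mathcomp Require Import all_boot all_order all_algebra.

Set Implicit Arguments.
Unset Strict Implicit.
Unset Printing Implicit Defensive.

Import Order.TTheory GRing.Theory Num.Theory.

Local Open Scope ring_scope.
Local Open Scope quotient_scope.

Definition is_sign (z : int) : bool := (z == 1) || (z == -1).

(* A finite simple graph on V with its signature. The sign of the edge uv is
   [sgn u v]; values of [sgn] at non-adjacent pairs are irrelevant. *)
Record signed_graph (V : finType) := SignedGraph {
  adj : rel V;
  sgn : V -> V -> int;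
  adj_sym : symmetric adj;
  adj_irr : irreflexive adj;
  sgn_sym : forall u v, adj u v -> sgn u v = sgn v u;
  sgn_sign : forall u v, adj u v -> is_sign (sgn u v)
}.

Record marked_signed_graph (V : finType) := MarkedSignedGraph {
  underlying :> signed_graph V;
  mark : V -> int;
  mark_sign : forall v, is_sign (mark v)
}.

Section SignedGraphs.
Variables (V : finType) (G : signed_graph V).

Definition edge : Type :=
  {e : {set V} | [exists u, exists v, adj G u v && (e == [set u; v])]}.

Definition ends (e : edge) : {set V} := sval e.

Definition deg (v : V) : nat := #|[set u | adj G v u]|.

Definition regular (gamma : nat) : Prop := forall v, deg v = gamma.

Record r_orientation := ROrientation {
  orient :> V -> edge -> int;
  orient_out : forall w e, w \notin ends e -> orient w e = 0;
  orient_end : forall u e, u \in ends e -> is_sign (orient u e);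
  orient_sgn : forall u v e, adj G u v -> ends e = [set u; v] ->
    orient u e * orient v e = sgn G u v
}.

(* The vertices v_1, ..., v_n are listed by [enum_val]. *)
Definition adjacency_mx (R : nzRingType) : 'M[R]_#|V| :=
  \matrix_(i, j) if adj G (enum_val i) (enum_val j)
                 then (sgn G (enum_val i) (enum_val j))%:~R else 0.

Definition degree_mx (R : nzRingType) : 'M[R]_#|V| :=
  diag_mx (\row_i (deg (enum_val i))%:R).

Definition Qmx (R : nzRingType) : 'M[R]_#|V| := degree_mx R + adjacency_mx R.

End SignedGraphs.

Definition mark_vec (V : finType) (G : marked_signed_graph V) (R : nzRingType) :
  'cV[R]_#|V| := \col_i (mark G (enum_val i))%:~R.

Section Subdivision.
Variables (V : finType) (G : signed_graph V) (theta : r_orientation G).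

Definition subdivision_adj (x y : V + edge G) : bool :=
  match x, y with
  | inl v, inr e | inr e, inl v => v \in ends e
  | _, _ => false
  end.

Definition subdivision_sgn (x y : V + edge G) : int :=
  match x, y with
  | inl v, inr e | inr e, inl v => theta v e
  | _, _ => 0
  end.

Fact subdivision_adj_sym : symmetric subdivision_adj.
Proof. by case=> [u|e] [v|f]. Qed.

Fact subdivision_adj_irr : irreflexive subdivision_adj.
Proof. by case. Qed.

Fact subdivision_sgn_sym x y :
  subdivision_adj x y -> subdivision_sgn x y = subdivision_sgn y x.
Proof. by case: x y => [u|e] [v|f]. Qed.

Fact subdivision_sgn_sign x y :
  subdivision_adj x y -> is_sign (subdivision_sgn x y).
Proof. by case: x y => [u|e] [v|f] //=; apply: orient_end. Qed.

Definition subdivision : signed_graph (V + edge G)%type :=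
  SignedGraph subdivision_adj_sym subdivision_adj_irr
              subdivision_sgn_sym subdivision_sgn_sign.

End Subdivision.

Fact is_signM a b : is_sign a -> is_sign b -> is_sign (a * b).
Proof. by move=> /orP[] /eqP-> /orP[] /eqP->. Qed.

(* [inr (t, u)] is the vertex u of the t-th copy of the second graph. The matrix
   Q does not involve a marking, so none is put on the corona. *)
Section Corona.
Variables (V1 V2 : finType) (G1 : signed_graph V1) (theta : r_orientation G1).
Variable G2 : marked_signed_graph V2.

Local Notation corona_vertex := ((V1 + edge G1) + V1 * V2)%type.

Definition sv_nbhd_corona_adj (x y : corona_vertex) : bool :=
  match x, y with
  | inl a, inl b => adj (subdivision theta) a b
  | inr (s, u), inr (t, v) => (s == t) && adj G2 u v
  | inl (inr e), inr (t, _) | inr (t, _), inl (inr e) => t \in ends e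
  | _, _ => false
  end.

Definition sv_nbhd_corona_sgn (x y : corona_vertex) : int :=
  match x, y with
  | inl a, inl b => sgn (subdivision theta) a b
  | inr (_, u), inr (_, v) => sgn G2 u v
  | inl (inr e), inr (t, u) | inr (t, u), inl (inr e) => theta t e * mark G2 u
  | _, _ => 0
  end.

Fact sv_nbhd_corona_adj_sym : symmetric sv_nbhd_corona_adj.
Proof.
by case=> [[a|e]|[s u]] [[b|f]|[t v]] //=; rewrite eq_sym adj_sym.
Qed.

Fact sv_nbhd_corona_adj_irr : irreflexive sv_nbhd_corona_adj.
Proof. by case=> [[a|e]|[s u]] //=; rewrite adj_irr andbF. Qed.

Fact sv_nbhd_corona_sgn_sym x y : sv_nbhd_corona_adj x y ->
  sv_nbhd_corona_sgn x y = sv_nbhd_corona_sgn y x.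
Proof.
by case: x y => [[a|e]|[s u]] [[b|f]|[t v]] //= /andP[_ /sgn_sym].
Qed.

Fact sv_nbhd_corona_sgn_sign x y : sv_nbhd_corona_adj x y ->
  is_sign (sv_nbhd_corona_sgn x y).
Proof.
case: x y => [[a|e]|[s u]] [[b|f]|[t v]] //=; try exact: orient_end.
- by move=> te; rewrite is_signM ?mark_sign ?orient_end.
- by move=> te; rewrite is_signM ?mark_sign ?orient_end.
- by case/andP=> _ /sgn_sign.
Qed.

Definition sv_nbhd_corona : signed_graph corona_vertex :=
  SignedGraph sv_nbhd_corona_adj_sym sv_nbhd_corona_adj_irr
              sv_nbhd_corona_sgn_sym sv_nbhd_corona_sgn_sign.

End Corona.

(* Rational functions in one variable over F are the elements of
   {fraction {poly F}}; poles and values are read off in lowest terms, so that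
   removable singularities are not poles. *)
Section RationalFunctions.
Variable F : fieldType.
Implicit Types (r : {fraction {poly F}}) (a : F).

Definition ratnum r : {poly F} :=
  \n_(repr r) %/ gcdp \n_(repr r) \d_(repr r).

Definition ratden r : {poly F} :=
  \d_(repr r) %/ gcdp \n_(repr r) \d_(repr r).

Definition pole r a : bool := root (ratden r) a.

Definition rateval r a : F := (ratnum r).[a] / (ratden r).[a].

Definition ratconst (c : F) : {fraction {poly F}} := tofrac c%:P.

Definition ratX : {fraction {poly F}} := tofrac 'X.

(* The rational function mu^T (X I - N)^{-1} mu. *)
Definition coronal n (mu : 'cV[F]_n) (N : 'M[F]_n) : {fraction {poly F}} :=
  ((map_mx ratconst mu)^T *m invmx (ratX%:M - map_mx ratconst N)
     *m map_mx ratconst mu) 0 0.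

End RationalFunctions.

Definition Qcoronal (F : fieldType) (V : finType) (G : marked_signed_graph V) :
  {fraction {poly F}} := coronal (mark_vec G F) (Qmx G F).

(* Main.v *)
Require Import Defs.
From HB Require Import structures.
(* [fingroup] comes first so that [repr] is the one of [generic_quotient]. *)
From mathcomp Require Import fingroup perm.
From mathcomp Require Import all_boot all_order all_algebra.
From mathcomp Require Import ring mxtens.

(** Put [x = lambda - gamma1], [d = lambda - 2 - 2 n2], and let [R] be the signed
    vertex-edge incidence matrix of [theta], so that [R R^T = Q(Gamma1)].
    Ordering the vertices as original vertices, inserted vertices, copies,
    [lambda I - Q] is a 3 x 3 block matrix with diagonal blocks [x I], [d I] and
    [I (x) (x I - Q(Gamma2))].  Eliminating the copies turns [d I] into
    [d I - s R^T R], where [s] is the value of the coronal at [x]; eliminating the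
    original vertices leaves [d I - (s + 1/x) R^T R], and Sylvester's identity
    replaces [R^T R] by [Q(Gamma1)].  This needs [x], [d] and
    [f_{Q(Gamma2)}(x)] to be nonzero; after clearing denominators both sides are
    polynomials in [lambda], so the identity persists at all other points. *)

Set Implicit Arguments.
Unset Strict Implicit.
Unset Printing Implicit Defensive.

Import Order.TTheory GRing.Theory Num.Theory.

Local Open Scope ring_scope.

(** * Determinants: Schur complements, Kronecker products, reindexing *)

Section Determinants.
Variable F : fieldType.

Lemma det_schur_dr m n (A : 'M[F]_m) (B : 'M_(m, n)) (C : 'M_(n, m)) (D : 'M_n) :
  D \in unitmx ->
  \det (block_mx A B C D) = \det D * \det (A - B *m invmx D *m C).
Proof.
move=> Du; have -> : block_mx A B C D =
    block_mx 1%:M (B *m invmx D) 0 1%:M *m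
    block_mx (A - B *m invmx D *m C) 0 C D.
  by rewrite mulmx_block !mul1mx ?mul0mx ?mulmx0 ?add0r ?addr0 subrK mulmxKV.
by rewrite det_mulmx det_ublock det_lblock !det1 !mul1r mulrC.
Qed.

Lemma det_schur_ul m n (A : 'M[F]_m) (B : 'M_(m, n)) (C : 'M_(n, m)) (D : 'M_n) :
  A \in unitmx ->
  \det (block_mx A B C D) = \det A * \det (D - C *m invmx A *m B).
Proof.
move=> Au; have -> : block_mx A B C D =
    block_mx 1%:M 0 (C *m invmx A) 1%:M *m
    block_mx A B 0 (D - C *m invmx A *m B).
  by rewrite mulmx_block !mul1mx ?mul0mx ?mulmx0 ?addr0 addrC subrK mulmxKV.
by rewrite det_mulmx det_ublock det_lblock !det1 !mul1r.
Qed.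

Lemma unitmx_scalar n (a : F) : a != 0 -> (a%:M : 'M_n) \in unitmx.
Proof. by move=> a0; rewrite unitmxE det_scalar unitfE expf_neq0. Qed.

Lemma detZ_invmx n (A : 'M[F]_n) :
  A \in unitmx -> \det A *: invmx A = \adj A.
Proof.
by move=> Au; rewrite -mul_scalar_mx -mul_adj_mx -mulmxA mulmxV // mulmx1.
Qed.

(** Both sides come from the two Schur complements of the block matrix with rows [d I, A] and
    [B, I]. Powers of [d] on both sides avoid a possibly negative exponent [m - n]. *)
Lemma det_sylvester m n (d : F) (A : 'M_(n, m)) (B : 'M_(m, n)) : d != 0 ->
  d ^+ n * \det (d%:M - B *m A) = d ^+ m * \det (d%:M - A *m B).
Proof.
move=> d0.
have := det_schur_dr d%:M A B (unitmx1 _ _).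
rewrite det_schur_ul ?unitmx_scalar // invmx1 mulmx1 det1 mul1r det_scalar.
move=> <-; rewrite mulrCA; congr (_ * _).
rewrite -detZ scalerBr scale_scalar_mx mulr1 invmx_scalar mul_mx_scalar.
by rewrite -scalemxAl scalerA divff // scale1r.
Qed.

(** The matrix is block diagonal with [n] copies of [N]; the induction splits off the first copy. *)
Lemma det_tens_1mx n k (N : 'M[F]_k) : \det (1%:M *t N : 'M_(n * k)) = \det N ^+ n.
Proof.
elim: n => [|n IHn]; first by rewrite det_mx00.
have -> : (1%:M *t N : 'M_(n.+1 * k)) = block_mx N 0 0 (1%:M *t N : 'M_(n * k)).
  apply/matrixP => i j.
  case: (mxtens_indexP i) => i0 i1; case: (mxtens_indexP j) => j0 j1.
  rewrite tensmxE mxE.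
  (* [mxtens_index (a, b)] has value [a * k + b]: [a = ord0] lands in the first [k] indices,
     [a = lift ord0 a'] in the remaining [n * k]. *)
  have E (a : 'I_n.+1) (b : 'I_k) : mxtens_index (a, b) =
      match unlift ord0 a with
      | None => lshift (n * k) b
      | Some a' => rshift k (mxtens_index (a', b))
      end.
    case: unliftP => [a'|] ->; apply: val_inj => //=.
    by rewrite /bump mulSn addnA.
  rewrite !E; case: unliftP => [i'|] ->; case: unliftP => [j'|] ->.
  - by rewrite block_mxEdr tensmxE mxE (inj_eq lift_inj).
  - by rewrite block_mxEdl mxE mul0r.
  - by rewrite block_mxEur mxE mul0r.
  - by rewrite block_mxEul mul1r.
by rewrite det_lblock IHn exprS.
Qed.

Lemma tensmx11 n k : (1%:M *t 1%:M : 'M[F]_(n * k)) = 1%:M.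
Proof.
apply/matrixP => i j.
case: (mxtens_indexP i) => i0 i1; case: (mxtens_indexP j) => j0 j1.
by rewrite tensmxE !mxE (can_eq (@mxtens_indexK _ _)) xpair_eqE -natrM mulnb.
Qed.

Lemma invmx_tens_1mx n k (N : 'M[F]_k) : N \in unitmx ->
  invmx (1%:M *t N : 'M_(n * k)) = 1%:M *t invmx N.
Proof.
move=> Nu.
have NV : (1%:M *t N : 'M_(n * k)) *m (1%:M *t invmx N) = 1%:M.
  by rewrite tensmx_mul mul1mx mulmxV // tensmx11.
have [Mu _] := mulmx1_unit NV.
by rewrite -[LHS]mulmx1 -NV mulKmx.
Qed.

(** For nonzero [b] the determinant is [b ^+ n] times the characteristic polynomial at [a / b]; for
    [b = 0] both sides are [a ^+ n]. *)
Lemma det_scalar_subZ n (N : 'M[F]_n) (e : 'I_n -> F) (a b : F) :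
  char_poly N = \prod_j ('X - (e j)%:P) ->
  \det (a%:M - b *: N) = \prod_j (a - b * e j).
Proof.
move=> Ne; have [->|b0] := eqVneq b 0.
  rewrite scale0r subr0 det_scalar.
  by under eq_bigr do rewrite mul0r subr0; rewrite prodr_const card_ord.
transitivity (b ^+ n * (char_poly N).[a / b]).
  rewrite -horner_evalE -det_map_mx -detZ; congr (\det _).
  apply/matrixP => i j; rewrite !mxE /= /horner_eval !hornerE.
  by rewrite hornerMn hornerX mulrBr mulrnAr mulrCA divff // mulr1.
rewrite Ne horner_prod -[in b ^+ n](card_ord n) -prodr_const -big_split /=.
by apply: eq_bigr => j _; rewrite !hornerE mulrBr mulrCA divff // mulr1.
Qed.

(** Two listings of [T] differ by a permutation, applied to rows and columns alike. This lets the
    corona be listed block by block although [Qmx] lists it by [enum_val]. *)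
Lemma det_reindex (T : finType) n (M : T -> T -> F) (g : 'I_n -> T) :
  bijective g ->
  \det (\matrix_(i < #|T|, j < #|T|) M (enum_val i) (enum_val j)) =
  \det (\matrix_(i < n, j < n) M (g i) (g j)).
Proof.
move=> gb; have nT : n = #|T| by rewrite -(bij_eq_card gb) card_ord.
case: _ / (esym nT) g gb => g gb {n nT}.
pose s := perm (inj_comp enum_rank_inj (bij_inj gb)).
have -> : \matrix_(i < #|T|, j < #|T|) M (g i) (g j) =
    row_perm s (col_perm s (\matrix_(i, j) M (enum_val i) (enum_val j))).
  by apply/matrixP => i j; rewrite !mxE !permE /= !enum_rankK.
rewrite row_permE col_permE !det_mulmx mulrCA -det_mulmx.
by rewrite -perm_mxM mulgV perm_mx1 det1 mulr1.
Qed.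

End Determinants.

(** * Rational functions in lowest terms and the coronal *)

Section RationalFunctions.
Variable F : fieldType.

Lemma ratden_neq0 (r : {fraction {poly F}}) : ratden r != 0.
Proof.
have d0 : (frac (repr r)).2 != 0 by exact: denom_ratioP.
rewrite /ratden divp_eq0 !negb_or d0 gcdp_eq0 negb_and d0 orbT /= -leqNgt.
by rewrite dvdp_leq // dvdp_gcdr.
Qed.

Lemma ratnumdenE (r : {fraction {poly F}}) :
  r * tofrac (ratden r) = tofrac (ratnum r).
Proof.
set n := (frac (repr r)).1; set d := (frac (repr r)).2.
have d0 : d != 0 by exact: denom_ratioP.
(* The unreduced representative is treated first; the gcd is cancelled afterwards. *)
have rd : r * tofrac d = tofrac n.
  rewrite -[r in LHS]reprK /d /n.
  case: (repr r) => -[n' d'] /= d'0; unlock tofrac.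
  rewrite -[LHS]FracField.pi_mul; apply/eqmodP.
  rewrite /= FracField.equivfE /FracField.mulf /= !numden_Ratio ?mulr1 ?oner_neq0 //=.
  by rewrite mulrC.
have g0 : gcdp n d != 0 by rewrite gcdp_eq0 negb_and d0 orbT.
apply: (@mulIf _ (tofrac (gcdp n d))); first by rewrite tofrac_eq0.
by rewrite -mulrA -!tofracM !divpK ?dvdp_gcdl ?dvdp_gcdr.
Qed.

(** Cramer's numerator of the coronal over the denominator [char_poly N]; this fraction may be
    reducible. *)
Definition coronal_num n (mu : 'cV[F]_n) (N : 'M[F]_n) : {poly F} :=
  ((map_mx polyC mu)^T *m \adj (char_poly_mx N) *m map_mx polyC mu) 0 0.

Let mulmx_entryZ (K : fieldType) (a : K) (A : 'M[K]_1) : a * A 0 0 = (a *: A) 0 0.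
Proof. by rewrite mxE. Qed.

(** Over the fraction field [X I - N] is invertible, its determinant being monic, and determinant
    times inverse is the adjugate, whose entries are polynomials. *)
Lemma coronalE n (mu : 'cV[F]_n) (N : 'M[F]_n) :
  coronal mu N * tofrac (char_poly N) = tofrac (coronal_num mu N).
Proof.
pose f := @FracField.tofrac {poly F}.
have Hmu : map_mx (@ratconst F) mu = map_mx f (map_mx polyC mu).
  by apply/matrixP => i j; rewrite !mxE.
have HN : (ratX F)%:M - map_mx (@ratconst F) N = map_mx f (char_poly_mx N).
  by rewrite /char_poly_mx map_mxB map_scalar_mx; congr (_ - _);
    apply/matrixP => i j; rewrite !mxE.
have Nu : map_mx f (char_poly_mx N) \in unitmx.
  by rewrite unitmxE det_map_mx unitfE tofrac_eq0 monic_neq0 ?char_poly_monic.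
rewrite /coronal Hmu HN matrix.map_trmx /coronal_num.
have -> : tofrac (char_poly N) = \det (map_mx f (char_poly_mx N)).
  by rewrite det_map_mx.
rewrite mulrC mulmx_entryZ scalemxAl scalemxAr.
by rewrite detZ_invmx // -map_mx_adj -!map_mxM mxE.
Qed.

(** The reduced fraction and Cramer's agree; cross-multiplied, this is an identity of polynomials
    and can be evaluated anywhere. *)
Lemma ratnumden_coronal n (mu : 'cV[F]_n) (N : 'M[F]_n) :
  ratnum (coronal mu N) * char_poly N = coronal_num mu N * ratden (coronal mu N).
Proof.
apply/eqP; rewrite -tofrac_eq !tofracM -ratnumdenE -coronalE.
by rewrite mulrAC.
Qed.

Lemma map_char_poly_mx_horner n (N : 'M[F]_n) x :
  map_mx (horner_eval x) (char_poly_mx N) = x%:M - N.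
Proof.
by apply/matrixP => i j; rewrite !mxE /= /horner_eval !hornerE hornerMn hornerX.
Qed.

Lemma horner_char_poly n (N : 'M[F]_n) x : (char_poly N).[x] = \det (x%:M - N).
Proof. by rewrite -horner_evalE -det_map_mx map_char_poly_mx_horner. Qed.

(** Evaluation at [x] is a ring morphism, so it commutes with the adjugate; dividing by the nonzero
    determinant of [x I - N] gives back the inverse. *)
Lemma rateval_coronal n (mu : 'cV[F]_n) (N : 'M[F]_n) x :
  (char_poly N).[x] != 0 -> (ratden (coronal mu N)).[x] != 0 ->
  rateval (coronal mu N) x = (mu^T *m invmx (x%:M - N) *m mu) 0 0.
Proof.
move=> f0 d0; have /(congr1 (horner^~ x)) := ratnumden_coronal mu N.
rewrite !hornerM => E.
have Nu : x%:M - N \in unitmx by rewrite unitmxE -horner_char_poly unitfE.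
rewrite /rateval; apply: (mulIf f0); rewrite mulrAC E mulfK //.
rewrite /coronal_num -horner_evalE.
have -> : forall A : 'M[{poly F}]_1, horner_eval x (A 0 0) =
    (map_mx (horner_eval x) A) 0 0 by move=> A; rewrite [RHS]mxE.
rewrite !map_mxM -matrix.map_trmx map_mx_adj map_char_poly_mx_horner.
have -> : map_mx (horner_eval x) (map_mx polyC mu) = mu.
  by apply/matrixP => i j; rewrite !mxE /horner_eval /= hornerC.
rewrite mulrC horner_char_poly mulmx_entryZ scalemxAl scalemxAr.
by rewrite detZ_invmx.
Qed.

End RationalFunctions.

(** [(P - Q) * h] vanishes at every point, in particular at more natural numbers than its degree;
    these are distinct in characteristic zero. *)
Lemma poly_eq_off_zeros (F : numFieldType) (P Q h : {poly F}) :
  h != 0 -> (forall a, h.[a] != 0 -> P.[a] = Q.[a]) -> P = Q.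
Proof.
move=> h0 PQ; apply/eqP; rewrite -subr_eq0.
suff: (P - Q) * h == 0 by rewrite mulf_eq0 (negPf h0) orbF.
apply/eqP/(@roots_geq_poly_eq0 _ _ [seq i%:R | i <- iota 0 (size ((P - Q) * h))]).
- apply/allP => a _; rewrite rootE hornerM hornerD hornerN.
  by have [->|/PQ ->] := eqVneq h.[a] 0; rewrite ?mulr0 // subrr mul0r.
- by rewrite map_inj_uniq ?iota_uniq // => i j /eqP; rewrite eqr_nat => /eqP.
- by rewrite size_map size_iota.
Qed.

Lemma is_sign_sqr (z : int) : is_sign z -> z * z = 1.
Proof. by case/orP => /eqP->. Qed.

Lemma sum_bool_card (T : finType) (P : pred T) : (\sum_x P x = #|[set x | P x]|)%N.
Proof. by rewrite -sum1dep_card [RHS]big_mkcond; apply: eq_bigr => x _; case: (P x). Qed.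

Lemma big_pairE (R : Type) (idx : R) (op : Monoid.com_law idx) (I J : finType)
    (f : I * J -> R) :
  \big[op/idx]_p f p = \big[op/idx]_i \big[op/idx]_j f (i, j).
Proof. by rewrite pair_bigA; apply: eq_bigr => -[]. Qed.

(** * The signed incidence matrix and its product with its transpose *)

Section Incidence.
Variables (V : finType) (G : signed_graph V) (theta : r_orientation G).

Lemma endsP (e : edge G) : exists u v, adj G u v /\ ends e = [set u; v].
Proof.
by case: e => e /= /existsP[u /existsP[v /andP[uv /eqP->]]]; exists u, v.
Qed.

Lemma adj_neq u v : adj G u v -> u != v.
Proof. by apply: contraTneq => ->; rewrite adj_irr. Qed.

Lemma card_ends (e : edge G) : #|ends e| = 2%N.
Proof. by have [u [v [/adj_neq uv ->]]] := endsP e; rewrite cards2 uv. Qed.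

Lemma edge_of_adj u v : adj G u v -> {e : edge G | ends e = [set u; v]}.
Proof.
move=> uv; have P : [exists a, exists b, adj G a b && ([set u; v] == [set a; b])].
  by apply/existsP; exists u; apply/existsP; exists v; rewrite uv eqxx.
by exists (Sub [set u; v] P : edge G).
Qed.

Lemma ends_inj : injective (@ends V G).
Proof. exact: val_inj. Qed.

Lemma ends_two u v (e : edge G) : u != v -> u \in ends e -> v \in ends e ->
  adj G u v /\ ends e = [set u; v].
Proof.
have [a [b [ab ->]]] := endsP e; rewrite !inE => uv.
case/orP=> /eqP Eu /orP[] /eqP Ev; move: uv ab; rewrite Eu Ev ?eqxx // => _ ab.
by rewrite adj_sym setUC.
Qed.

(** Edges at [v] correspond to neighbours [u] through [[set v; u]]; both sides count the same family
    of vertex pairs. *)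
Lemma sum_edges_at v : (\sum_(e : edge G) (v \in ends e) = deg G v)%N.
Proof.
rewrite sum_bool_card -(card_imset _ ends_inj) /deg.
have inj : {in [set u | adj G v u] &, injective (fun u => [set v; u])}.
  move=> a b; rewrite !inE => /adj_neq va /adj_neq vb /setP/(_ a).
  by rewrite !inE eqxx orbT eq_sym (negPf va) => /esym/eqP.
rewrite -(card_in_imset inj); apply: eq_card => A.
apply/imsetP/imsetP => -[].
  move=> e; rewrite !inE => ve ->.
  have [a [b [ab E]]] := endsP e; move: ve; rewrite E !inE.
  case/orP=> /eqP->; first by exists b; rewrite ?inE.
  by exists a; rewrite ?inE 1?adj_sym // setUC.
by move=> u; rewrite inE => /edge_of_adj[e E] ->; exists e; rewrite ?inE E // !inE eqxx.
Qed.

Definition incidence_mx (R : nzRingType) : 'M[R]_(#|V|, #|{: edge G}|) :=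
  \matrix_(i, e) (theta (enum_val i) (enum_val e))%:~R.

(** These are the entries of [R R^T] over [int]. For [u = v] each incident edge contributes the
    square of a sign; for [u != v] only an edge joining them contributes, and the r-orientation
    makes that its sign. *)
Lemma sum_orient u v : \sum_(e : edge G) theta u e * theta v e =
  (if u == v then (deg G u)%:R else 0) + (if adj G u v then sgn G u v else 0).
Proof.
have [<-|uv] := eqVneq u v.
  rewrite adj_irr addr0 -sum_edges_at natr_sum; apply: eq_bigr => e _.
  have [ue|ue] := boolP (u \in ends e); first by rewrite is_sign_sqr ?orient_end.
  by rewrite orient_out ?mul0r.
rewrite add0r; have [auv|nuv] := ifPn.
  have [e E] := edge_of_adj auv.
  rewrite (bigD1 e) //= (orient_sgn theta auv E) big1 ?addr0 // => f fe.
  have [uf|uf] := boolP (u \in ends f); last by rewrite orient_out ?mul0r.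
  have [vf|vf] := boolP (v \in ends f); last by rewrite mulrC orient_out ?mul0r.
  have [_ Ef] := ends_two uv uf vf.
  by case/eqP: fe; apply: ends_inj; rewrite E Ef.
rewrite big1 // => f _.
have [uf|uf] := boolP (u \in ends f); last by rewrite orient_out ?mul0r.
have [vf|vf] := boolP (v \in ends f); last by rewrite mulrC orient_out ?mul0r.
by have [auv] := ends_two uv uf vf; rewrite auv in nuv.
Qed.

(** Each entry is the image of a single integer, so sums over edges can be computed in [int] and
    cast afterwards. *)
Lemma QmxE (R : nzRingType) i j : Qmx G R i j =
  ((if enum_val i == enum_val j then (deg G (enum_val i))%:R else 0) +
  (if adj G (enum_val i) (enum_val j) then sgn G (enum_val i) (enum_val j) else 0))%:~R.
Proof.
rewrite !mxE (inj_eq enum_val_inj) rmorphD /=; congr (_ + _); last by case: ifP.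
by case: eqP => _; rewrite ?mulr0n // mulr1n rmorph_nat.
Qed.

Lemma incidence_mulT (R : nzRingType) :
  incidence_mx R *m (incidence_mx R)^T = Qmx G R.
Proof.
apply/matrixP => i j; rewrite QmxE -sum_orient [RHS]rmorph_sum mxE.
rewrite [RHS](reindex (fun e : 'I_#|{: edge G}| => enum_val e)) /=; last first.
  exact/onW_bij/enum_val_bij.
by apply: eq_bigr => e _; rewrite !mxE rmorphM.
Qed.

End Incidence.

(** * Degrees in the corona and a block ordering of its vertices *)

Section Corona.
Variables (V1 V2 : finType) (G1 : signed_graph V1) (theta : r_orientation G1).
Variable G2 : marked_signed_graph V2.
Local Notation E1 := (edge G1).
Local Notation n1 := #|V1|.
Local Notation m1 := #|{: E1}|.
Local Notation n2 := #|V2|.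
Local Notation G := (sv_nbhd_corona theta G2).

Lemma deg_sum (V : finType) (H : signed_graph V) v :
  deg H v = (\sum_u adj H v u)%N.
Proof. by rewrite sum_bool_card. Qed.

Lemma deg_corona_vertex v : deg G (inl (inl v)) = deg G1 v.
Proof.
rewrite deg_sum !big_sumType /= big1 // add0n.
by rewrite [X in (_ + X)%N]big1 ?addn0 ?sum_edges_at // => -[].
Qed.

(** An inserted vertex sees the two ends of its edge and, for each end, all [n2] vertices of the
    corresponding copy. *)
Lemma deg_corona_edge e : deg G (inl (inr e)) = (2 + 2 * n2)%N.
Proof.
have S : (\sum_v (v \in ends e) = 2)%N.
  by rewrite sum_bool_card -(card_ends e); apply: eq_card => v; rewrite inE.
rewrite deg_sum !big_sumType /= S [X in (_ + X + _)%N]big1 // addn0.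
rewrite big_pairE /=.
by under eq_bigr do rewrite sum_nat_const mulnC; rewrite -big_distrl /= S.
Qed.

Lemma deg_corona_copy t u : deg G (inr (t, u)) = (deg G1 t + deg G2 u)%N.
Proof.
rewrite deg_sum !big_sumType /= big1 // add0n sum_edges_at; congr (_ + _)%N.
rewrite big_pairE /=.
rewrite (bigD1 t) //= [X in (_ + X)%N]big1 ?addn0; last first.
  by move=> s /negPf; rewrite eq_sym => ->; rewrite big1.
by rewrite deg_sum; apply: eq_bigr => v _; rewrite eqxx.
Qed.

(** The order is original vertices, inserted vertices, copies. Copies follow the index order of
    [*t], so that their diagonal block is a Kronecker product. *)
Definition corona_enum (i : 'I_((n1 + m1) + n1 * n2)) : (V1 + E1) + V1 * V2 :=
  match split i with
  | inl j => inl (match split j with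
                  | inl a => inl (enum_val a)
                  | inr b => inr (enum_val b)
                  end)
  | inr k => inr (enum_val (mxtens_unindex k).1, enum_val (mxtens_unindex k).2)
  end.

Definition corona_rank (x : (V1 + E1) + V1 * V2) : 'I_((n1 + m1) + n1 * n2) :=
  match x with
  | inl (inl v) => lshift _ (lshift _ (enum_rank v))
  | inl (inr e) => lshift _ (rshift _ (enum_rank e))
  | inr (t, u) => rshift _ (mxtens_index (enum_rank t, enum_rank u))
  end.

Lemma corona_rankK : cancel corona_rank corona_enum.
Proof.
case=> [[v|e]|[t u]]; rewrite /corona_rank /corona_enum.
- by rewrite !(unsplitK (inl _)) enum_rankK.
- by rewrite (unsplitK (inl _)) (unsplitK (inr _)) enum_rankK.
- by rewrite (unsplitK (inr _)) mxtens_indexK /= !enum_rankK.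
Qed.

Lemma corona_enum_vertex i :
  corona_enum (lshift _ (lshift _ i)) = inl (inl (enum_val i)).
Proof. by rewrite /corona_enum !(unsplitK (inl _)). Qed.

Lemma corona_enum_edge i :
  corona_enum (lshift _ (rshift _ i)) = inl (inr (enum_val i)).
Proof. by rewrite /corona_enum (unsplitK (inl _)) (unsplitK (inr _)). Qed.

Lemma corona_enum_copy t u :
  corona_enum (rshift _ (mxtens_index (t, u))) = inr (enum_val t, enum_val u).
Proof. by rewrite /corona_enum (unsplitK (inr _)) mxtens_indexK. Qed.

Lemma corona_enum_bij : bijective corona_enum.
Proof.
apply: (@Bijective _ _ _ corona_rank); last exact: corona_rankK.
move=> i; case: (split_ordP i) => [j ->|k ->].
  case: (split_ordP j) => [a ->|b ->].
    by rewrite corona_enum_vertex /= enum_valK.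
  by rewrite corona_enum_edge /= enum_valK.
case: (mxtens_indexP k) => t u.
by rewrite corona_enum_copy /= !enum_valK.
Qed.


End Corona.

(** * The block determinant of the corona and its elimination *)

Section CoronaDeterminant.
Variables (V1 V2 : finType) (G1 : signed_graph V1) (theta : r_orientation G1).
Variable G2 : marked_signed_graph V2.
Variable F : fieldType.
Local Notation E1 := (edge G1).
Local Notation n1 := #|V1|.
Local Notation m1 := #|{: E1}|.
Local Notation n2 := #|V2|.
Local Notation G := (sv_nbhd_corona theta G2).
Local Notation Rmx := (incidence_mx theta F).
Local Notation mu := (mark_vec G2 F).

(** This is the Kronecker product of [I] and [mu^T], given entrywise because [1%:M *t mu^T] would
    have [n1 * 1] rows. *)
Definition copy_mark_mx : 'M[F]_(n1, n1 * n2) :=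
  \matrix_(t, k) ((t == (mxtens_unindex k).1)%:R * mu (mxtens_unindex k).2 0).

Lemma mul_copy_mark m (A : 'M[F]_(m, n1)) e t u :
  (A *m copy_mark_mx) e (mxtens_index (t, u)) = A e t * mu u 0.
Proof.
rewrite mxE (bigD1 t) //= big1 => [|s /negPf st]; rewrite !mxE mxtens_indexK /=.
  by rewrite eqxx mul1r addr0.
by rewrite st mul0r mulr0.
Qed.

Lemma sum_mxtens m n (f : 'I_(m * n) -> F) :
  \sum_k f k = \sum_i \sum_j f (mxtens_index (i, j)).
Proof.
rewrite pair_bigA (reindex (@mxtens_index m n)) /=; first by apply: eq_bigr => -[].
by exists (@mxtens_unindex m n) => k _; rewrite (mxtens_indexK, mxtens_unindexK).
Qed.

Lemma copy_mark_tens (N : 'M[F]_n2) s t v :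
  (copy_mark_mx *m (1%:M *t N)) s (mxtens_index (t, v)) =
  (s == t)%:R * (mu^T *m N) 0 v.
Proof.
rewrite mxE sum_mxtens (bigD1 s) //= [X in _ + X]big1 ?addr0; last first.
  move=> r /negPf rs; rewrite big1 // => u _.
  by rewrite [X in X * _]mxE mxtens_indexK /= eq_sym rs !mul0r.
rewrite [in RHS]mxE mulr_sumr; apply: eq_bigr => u _.
rewrite tensmxE [X in X * _]mxE mxtens_indexK /= eqxx mul1r [1%:M _ _]mxE.
by rewrite mulrCA [mu^T _ _]mxE.
Qed.

(** By the mixed product rule this is [I] tensored with the 1 x 1 matrix [mu^T N mu]; hence
    eliminating the copies leaves only the coronal. *)
Lemma copy_mark_quad (N : 'M[F]_n2) :
  copy_mark_mx *m (1%:M *t N) *m copy_mark_mx^T = ((mu^T *m N *m mu) 0 0)%:M.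
Proof.
apply/matrixP => s t; rewrite mxE sum_mxtens (bigD1 s) //= [X in _ + X]big1 ?addr0.
  rewrite mxE mxE -mulr_natr mulr_suml; apply: eq_bigr => u _.
  rewrite copy_mark_tens eqxx mul1r -mulrA; congr (_ * _).
  by rewrite mxE mxE mxtens_indexK /= mulrC eq_sym.
move=> r /negPf rs; rewrite big1 // => u _.
by rewrite copy_mark_tens eq_sym rs !mul0r.
Qed.

Variable gamma : nat.
Hypothesis G1_regular : regular G1 gamma.

Lemma det_corona_block (a : F) (x := a - gamma%:R) (d := a - 2 - 2 * n2%:R)
    (W := col_mx 0 (- (Rmx^T *m copy_mark_mx))) :
  \det (a%:M - Qmx G F) =
  \det (block_mx (block_mx x%:M (- Rmx) (- Rmx^T) d%:M) W W^T
          (1%:M *t (x%:M - Qmx G2 F))).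
Proof.
(* The entry is written as a function of two vertices, the form required by [det_reindex]. *)
pose M p q : F := (if p == q then a else 0) -
  ((if p == q then (deg G p)%:R else 0) + (if adj G p q then sgn G p q else 0))%:~R.
have -> : a%:M - Qmx G F = \matrix_(i, j) M (enum_val i) (enum_val j).
  apply/matrixP => i j; rewrite [RHS]mxE /M -QmxE !mxE (inj_eq enum_val_inj).
  by case: eqP.
rewrite (det_reindex _ (@corona_enum_bij V1 V2 G1)); congr (\det _).
have Wv i t u : W (lshift _ i) (mxtens_index (t, u)) = 0 by rewrite col_mxEu mxE.
have We e t u : W (rshift _ e) (mxtens_index (t, u)) =
    - (theta (enum_val t) (enum_val e) * mark G2 (enum_val u))%:~R.
  by rewrite col_mxEd mxE mul_copy_mark !mxE rmorphM.
have out v e : v \notin ends e -> theta v e = 0 := @orient_out _ _ theta v e.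
have ifth v e c : (if v \in ends e then theta v e * c else 0) = theta v e * c.
  by case: ifPn => // /out ->; rewrite mul0r.
have ifth1 v e : (if v \in ends e then theta v e else 0) = theta v e.
  by case: ifPn => // /out ->.
apply/matrixP => i j; rewrite mxE.
case: (split_ordP i) => [{}i ->|k ->]; case: (split_ordP j) => [{}j ->|l ->].
- rewrite block_mxEul.
  case: (split_ordP i) => [{}i ->|k ->]; case: (split_ordP j) => [{}j ->|l ->];
  rewrite ?block_mxEul ?block_mxEur ?block_mxEdl ?block_mxEdr
    ?corona_enum_vertex ?corona_enum_edge /M /= !mxE ?ifth1 ?add0r ?sub0r //.
  + rewrite (inj_eq (inj_comp (@inl_inj _ _) (@inl_inj _ _))) (inj_eq enum_val_inj).
    rewrite deg_corona_vertex G1_regular addr0 /x.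
    by case: eqP; rewrite ?subr0 ?mulr0n ?mulr1n // rmorph_nat.
  + rewrite (inj_eq (inj_comp (@inl_inj _ _) (@inr_inj _ _))) (inj_eq enum_val_inj).
    rewrite deg_corona_edge addr0 /d.
    case: eqP; rewrite ?subr0 ?mulr0n ?mulr1n // => _.
    by rewrite rmorph_nat natrD natrM opprD addrA.
- rewrite block_mxEur; case: (mxtens_indexP l) => t u.
  case: (split_ordP i) => [{}i ->|k ->]; rewrite ?Wv ?We
    ?corona_enum_vertex ?corona_enum_edge corona_enum_copy /M /= ?ifth ?add0r ?sub0r //.
  by rewrite oppr0.
- rewrite block_mxEdl mxE; case: (mxtens_indexP k) => t u.
  case: (split_ordP j) => [{}j ->|l ->]; rewrite ?Wv ?We
    ?corona_enum_vertex ?corona_enum_edge corona_enum_copy /M /= ?ifth ?add0r ?sub0r //.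
  by rewrite oppr0.
rewrite block_mxEdr.
case: (mxtens_indexP k) => s u; case: (mxtens_indexP l) => t v.
rewrite !corona_enum_copy tensmxE /M /= (inj_eq (@inr_inj _ _)) xpair_eqE.
rewrite [1%:M _ _]mxE deg_corona_copy G1_regular (inj_eq enum_val_inj).
rewrite !mxE (inj_eq enum_val_inj).
case: (s == t) => /=; last by rewrite mul0r subr0.
rewrite mul1r; case: (u == v); rewrite ?mulr0n ?mulr1n /x rmorphD /=.
  by rewrite rmorph_nat natrD; case: ifP => _; rewrite ?mulr0z !opprD !addrA.
by rewrite !add0r; case: ifP; rewrite ?mulr0z ?add0r.
Qed.

Lemma det_corona (a : F) (x := a - gamma%:R) (d := a - 2 - 2 * n2%:R)
    (s := (mu^T *m invmx (x%:M - Qmx G2 F) *m mu) 0 0) :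
  x != 0 -> d != 0 -> \det (x%:M - Qmx G2 F) != 0 ->
  d ^+ n1 * \det (a%:M - Qmx G F) =
  d ^+ m1 * \det (x%:M - Qmx G2 F) ^+ n1 *
    \det ((x * d)%:M - (1 + x * s) *: Qmx G1 F).
Proof.
move=> x0 d0 f0; rewrite det_corona_block -/x -/d.
have Bu : x%:M - Qmx G2 F \in unitmx by rewrite unitmxE unitfE.
rewrite det_schur_dr; last by rewrite unitmxE det_tens_1mx unitfE expf_neq0.
rewrite det_tens_1mx invmx_tens_1mx // mulrCA -mulrA [RHS]mulrCA; congr (_ * _).
rewrite tr_col_mx trmx0 mul_col_mx mul_col_row !mul0mx !mulmx0.
rewrite linearN /= !(mulNmx, mulmxN) opprK trmx_mul trmxK.
have -> T : Rmx^T *m copy_mark_mx *m T *m (copy_mark_mx^T *m Rmx) =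
    Rmx^T *m (copy_mark_mx *m T *m copy_mark_mx^T) *m Rmx by rewrite !mulmxA.
rewrite copy_mark_quad -/s mul_mx_scalar -scalemxAl.
rewrite opp_block_mx add_block_mx !oppr0 !addr0.
rewrite det_schur_ul ?unitmx_scalar // det_scalar.
rewrite invmx_scalar mul_mx_scalar mulmxN -!scalemxAl mulNmx scalerN opprK.
(* The multiples [s] and [1/x] of [R^T R] merge; the scalar is moved onto [R^T] so that Sylvester's
   identity applies. *)
rewrite -addrA -opprD -scalerDl [X in _ - X]scalemxAl mulrCA det_sylvester //.
(* The factor [x ^+ n1] enters the determinant and clears [1/x], since
   [x * (s + 1/x) = 1 + x * s]. *)
rewrite -scalemxAr incidence_mulT mulrCA -detZ; congr (_ * \det _).
rewrite scalerBr scale_scalar_mx scalerA; congr (_ - _ *: _).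
by rewrite mulrDr divff // addrC.
Qed.

End CoronaDeterminant.

(* Clearing denominators keeps the identity meaningful at the zeros of
   [char_poly (Qmx G2 C)] that are not poles of the coronal. *)
Lemma char_poly_corona (C : numFieldType) (V1 V2 : finType)
    (G1 : signed_graph V1) (G2 : marked_signed_graph V2)
    (theta : r_orientation G1) (gamma : nat) (eig : 'I_#|V1| -> C)
    (X := 'X - gamma%:R%:P) (D := 'X - (2 + 2 * #|V2|%:R)%:P)
    (num := ratnum (Qcoronal C G2) \Po X) (den := ratden (Qcoronal C G2) \Po X) :
  regular G1 gamma ->
  char_poly (Qmx G1 C) = \prod_j ('X - (eig j)%:P) ->
  D ^+ #|V1| * (den ^+ #|V1| * char_poly (Qmx (sv_nbhd_corona theta G2) C)) =
  D ^+ #|{: edge G1}| * ((char_poly (Qmx G2 C) \Po X) ^+ #|V1| *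
    \prod_j (den * (X * D) - (den + X * num) * (eig j)%:P)).
Proof.
move=> reg1 eigP.
have X0 (p : {poly C}) : p != 0 -> p \Po X != 0.
  by move=> p0; rewrite comp_poly_eq0 // size_XsubC.
(* The first three factors secure the hypotheses of [det_corona]; the last allows the coronal to be
   read as [num / den]. *)
apply: (@poly_eq_off_zeros _ _ _ (X * D * (char_poly (Qmx G2 C) \Po X) * den)).
  have [XN0 DN0] : X != 0 /\ D != 0 by rewrite !polyXsubC_eq0.
  by rewrite !mulf_neq0 // X0 ?ratden_neq0 // monic_neq0 ?char_poly_monic.
move=> a; have Xa : X.[a] = a - gamma%:R by rewrite !hornerE.
have Da : D.[a] = a - 2 - 2 * #|V2|%:R by rewrite !hornerE opprD addrA.
rewrite !hornerM !horner_comp !mulf_eq0 !negb_or => /andP[/andP[/andP[x0 d0] f0] e0].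
rewrite !horner_exp horner_prod !horner_comp.
have := rateval_coronal (mu := mark_vec G2 C) f0 e0; rewrite /rateval.
rewrite !horner_char_poly mulrCA in f0 *.
move: x0 d0 f0 e0; rewrite {}Xa {}Da => x0 d0 f0 e0 sE.
rewrite (det_corona theta reg1) // -sE (det_scalar_subZ _ _ eigP).
rewrite mulrCA -!mulrA; congr (_ * (_ * _)).
(* Each eigenvalue factor receives one [den], which clears its denominator. *)
rewrite -[in X in X * _](card_ord #|V1|) -prodr_const -big_split /=.
apply: eq_bigr => j _.
rewrite !(hornerE, horner_comp) -/(Qcoronal C G2) /=.
by field.
Qed.

Theorem theorem5p9 (C : numClosedFieldType) (V1 V2 : finType)
    (n1 m1 n2 gamma1 : nat)
    (Gamma1 : marked_signed_graph V1) (Gamma2 : marked_signed_graph V2)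
    (theta : r_orientation Gamma1)
    (card_V1 : #|V1| = n1) (card_E1 : #|{: edge Gamma1}| = m1)
    (card_V2 : #|V2| = n2)
    (regular1 : regular Gamma1 gamma1)
    (eig : 'I_n1 -> C)
    (eigP : char_poly (Qmx Gamma1 C) = \prod_(j < n1) ('X - (eig j)%:P))
    (lambda : C)
    (not_pole : ~~ pole (Qcoronal C Gamma2) (lambda - gamma1%:R))
    (* the integer power below must not be a negative power of 0 *)
    (pow_def : (m1 < n1)%N -> lambda - 2 - 2 * n2%:R != 0) :
  (char_poly (Qmx (sv_nbhd_corona theta Gamma2) C)).[lambda] =
  (lambda - 2 - 2 * n2%:R) ^ (m1%:Z - n1%:Z) *
  (char_poly (Qmx Gamma2 C)).[lambda - gamma1%:R] ^+ n1 *
  \prod_(j < n1)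
    (lambda ^+ 2 - (gamma1%:R + 2 + 2 * n2%:R) * lambda
     + 2 * gamma1%:R * (n2%:R + 1)
     - (1 + (lambda - gamma1%:R) *
            rateval (Qcoronal C Gamma2) (lambda - gamma1%:R)) * eig j).
Proof.
case: _ / card_V2 pow_def => pow_def.
case: _ / card_V1 eig eigP pow_def => eig eigP pow_def.
have := char_poly_corona Gamma2 theta regular1 eigP.
rewrite card_E1; set X := 'X - gamma1%:R%:P; set D := 'X - _%:P.
set P := char_poly (Qmx (sv_nbhd_corona _ _) _).
set den := ratden _ \Po X; set num := ratnum _ \Po X.
set f := char_poly _ \Po X; set prd := \prod_j _; set d := lambda - 2 - _ => PE.
have DE : D.[lambda] = d by rewrite !hornerE opprD addrA.
have XE : X.[lambda] = lambda - gamma1%:R by rewrite !hornerE.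
have e0 : den.[lambda] != 0 by rewrite horner_comp XE.
have {}PE : den.[lambda] ^+ #|V1| * P.[lambda] =
    d ^ (m1%:Z - #|V1|%:Z) * (f.[lambda] ^+ #|V1| * prd.[lambda]).
  (* If [#|V1| <= m1], [D ^+ #|V1|] is cancelled as a nonzero polynomial, so [d = 0] is allowed.
     Otherwise [pow_def] gives [d != 0] and the cancellation takes place after evaluation. *)
  have [n1m1|m1n1] := leqP #|V1| m1.
    have D0 : D ^+ #|V1| != 0 by rewrite expf_neq0 ?polyXsubC_eq0.
    rewrite subzn // -exprnP -DE -(horner_exp den) -(horner_exp D) -(horner_exp f).
    rewrite -!hornerM; congr (_.[_]).
    by apply: (mulfI D0); rewrite PE [RHS]mulrA -exprD subnKC.
  have d0 := pow_def m1n1.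
  have dn0 : d ^+ #|V1| != 0 by rewrite expf_neq0.
  have dE : d ^+ #|V1| * d ^ (m1%:Z - #|V1|%:Z) = d ^+ m1.
    by rewrite exprnP -expfzDr // addrC subrK.
  apply: (mulfI dn0); rewrite [RHS]mulrA dE.
  have := congr1 (horner^~ lambda) PE.
  by rewrite !hornerM !horner_exp DE.
(* As [lambda - gamma1] is not a pole, [den] is nonzero at [lambda] and its power can be
   cancelled. *)
apply: (mulfI (expf_neq0 #|V1| e0)); rewrite PE -mulrA [RHS]mulrCA; congr (_ * _).
rewrite horner_comp XE [RHS]mulrCA; congr (_ * _).
rewrite /prd horner_prod -[in _ ^+ _](card_ord #|V1|) -prodr_const -big_split /=.
apply: eq_bigr => j _.
rewrite hornerD hornerN !hornerM XE DE hornerC hornerD hornerM XE /rateval /d.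
rewrite !horner_comp XE; move: e0; rewrite horner_comp XE => e0.
(* The quadratic in [lambda] is the expansion of [(lambda - gamma1) * d]. *)
by field.
Qed.
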